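(* There exist an integer $N\ge1$ and a real number $M>0$ such that the following holds. Let $f:[0,\infty)\to\mathbb R$ be of class $C^N$ with $\sup_{x\ge0}(1+x)^M|f^{(j)}(x)|<\infty$ for $j=0,\dots,N$, and for $\mu>0$ define $$F(\mu):=\sum_{n=1}^\infty(2n+1)\,f\big(\mu\,n(n+1)\big).$$ Then, as $\mu\to0^+$, $$F(\mu)=\frac1\mu\int_0^\infty f(x)\,dx-\frac23f(0)-\frac1{15}\mu f'(0)+O(\mu^2).$$ *)

(* Defs.v *)
From Stdlib Require Import Reals Lra.
From Coquelicot Require Import Coquelicot.
Open Scope R_scope.

Definition half_line (x : R) : Prop := 0 <= x.

(* Coquelicot's [is_derive] with [locally x] restricted to [0, +oo): at x = 0
   it is the right derivative, and the values of f on x < 0 play no role. *)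
Definition is_derive_half (f : R -> R) (x l : R) : Prop :=
  filterdiff f (within half_line (locally x)) (fun h : R => scal h l).

(* f is of class C^N on [0, +oo), and df j agrees there with the j-th
   derivative of f for j <= N (which determines df j on [0, +oo)). *)
Definition Cn_half (N : nat) (f : R -> R) (df : nat -> R -> R) : Prop :=
  (forall x, half_line x -> df 0%nat x = f x) /\
  (forall j x, (j < N)%nat -> half_line x ->
     is_derive_half (df j) x (df (S j) x)) /\
  continuous_on half_line (df N).

Definition F_term (f : R -> R) (mu : R) (n : nat) : R :=
  (2 * INR n + 1) * f (mu * (INR n * (INR n + 1))).

(* [Series] starts at index 0, the sum at n = 1. *)
Definition F (f : R -> R) (mu : R) : R := Series (fun k => F_term f mu (S k)).

(* Main.v *)
Require Import Defs.
From Stdlib Require Import Reals Factorial Lra Lia.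
From Coquelicot Require Import Coquelicot.
Open Scope R_scope.
Set Bullet Behavior "Strict Subproofs".

(** The expansion is the Euler-Maclaurin formula for the function
    [g x = (2x + 1) f(mu x (x + 1))]. The factor [2x + 1] is the derivative of
    [x (x + 1)], so [g] has the explicit primitive [Phi(mu x (x + 1)) / mu] where
    [Phi y] is the integral of [f] over [0, y]; this gives the leading term. With
    [T = primitive - g/2 + g'/12 - g'''/720], each increment [T (n+1) - T n] equals
    [g n] up to the supremum of [|g^(6)|] on [n, n+1] ([euler_maclaurin_step],
    which is just Taylor's inequality used four times).

    At scale [x ~ mu^(-1/2)] each derivative gains a factor [mu^(1/2)]; precisely
    [g^(6)] is bounded by [C mu^3 (2x+1) / (1 + mu x (x+1))^2]
    ([summand_chain_top_bound]), which is [C mu^2] times a telescoping difference of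
    [1 / (1 + mu n (n+1))]. So all the errors together are [O(mu^2)], uniformly in
    the number of terms ([partial_sum_bound]). Six derivatives are needed for this:
    stopping at [g^(4)] would only give [O(mu)].

    Letting the number of terms go to infinity, [T n] tends to the integral of [f]
    divided by [mu] ([corrected_primitive_cv]), and [T 0] provides the boundary
    coefficients ([corrected_primitive_0]): [-1/3 f 0 + mu/15 f' 0 + O(mu^2)].
    It enters as [- T 0], and removing the term of index 0, equal to [f 0], turns
    the resulting [1/3] into [-2/3].

    The hypotheses concern the half-line only. Replacing each derivative by its
    composition with [Rmax 0] makes them continuous on the line and differentiable
    on [x > 0], which is exactly what the mean value theorem asks for. *)

(** * Taylor's inequality and one Euler-Maclaurin step *)

(** The recursion on [k], rather than a sum, lets the polynomial of a fixed
    degree unfold by computation. *)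
Fixpoint taylor_poly (h : nat -> R -> R) (a : R) (k : nat) (x : R) : R :=
  match k with
  | O => 0
  | S i => taylor_poly h a i x + h i a * ((x - a) ^ i / INR (fact i))
  end.

Lemma is_derive_pow_fact (a x : R) (k : nat) :
  is_derive (fun t => (t - a) ^ S k / INR (fact (S k))) x
            ((x - a) ^ k / INR (fact k)).
Proof.
replace ((x - a) ^ k / INR (fact k))
  with (INR (S k) * (x - a) ^ k / INR (fact (S k))).
- generalize (INR (fact (S k))); intros c.
  auto_derive; [easy|].
  change (1 * (INR (S k) * (x + - a) ^ k) * / c = INR (S k) * (x - a) ^ k / c).
  unfold Rdiv, Rminus; ring.
- rewrite fact_simpl, mult_INR.
  field; split; [apply INR_fact_neq_0|apply not_0_INR; lia].
Qed.

Lemma is_derive_taylor_poly (h : nat -> R -> R) (a x : R) (k : nat) :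
  is_derive (taylor_poly h a (S k)) x (taylor_poly (fun i => h (S i)) a k x).
Proof.
induction k as [|k IH].
- simpl; auto_derive; [easy|ring].
- apply (is_derive_plus (taylor_poly h a (S k))
           (fun t => h (S k) a * ((t - a) ^ S k / INR (fact (S k))))); [exact IH|].
  apply (is_derive_scal (fun t => (t - a) ^ S k / INR (fact (S k)))).
  apply is_derive_pow_fact.
Qed.

Lemma taylor_poly_center (h : nat -> R -> R) (a : R) (k : nat) :
  taylor_poly h a (S k) a = h 0%nat a.
Proof.
induction k as [|k IH]; simpl; [field|].
simpl in IH; rewrite IH, Rminus_diag; unfold Rdiv; ring.
Qed.

(** Continuity is asked up to the endpoints but differentiability only inside:
    the function to which this is applied is built from derivatives of [f], which
    at 0 are one-sided. *)
Lemma le_of_nonneg_derive (phi dphi : R -> R) (a b : R) :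
  a <= b ->
  (forall x, a <= x <= b -> continuous phi x) ->
  (forall x, a < x < b -> is_derive phi x (dphi x)) ->
  (forall x, a <= x <= b -> 0 <= dphi x) ->
  phi a <= phi b.
Proof.
intros Hab Hc Hd Hp.
destruct (MVT_gen phi a b dphi) as [c [Hcab Heq]];
  rewrite ?Rmin_left, ?Rmax_right in * by lra.
- intros x Hx; apply Hd; lra.
- intros x Hx; apply continuity_pt_filterlim, Hc; lra.
- specialize (Hp c Hcab); nra.
Qed.

(** Induction on [k]: the error has derivative equal to the error of order one
    less for the shifted chain, so [B (x - a)^k / k!] minus plus or minus the error
    is nondecreasing and vanishes at [a]. *)
Lemma taylor_remainder (k : nat) : forall (h : nat -> R -> R) (a b B : R),
  (forall j x, (j < k)%nat -> a <= x <= b -> continuous (h j) x) ->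
  (forall j x, (j < k)%nat -> a < x < b -> is_derive (h j) x (h (S j) x)) ->
  (forall x, a <= x <= b -> Rabs (h k x) <= B) ->
  forall x, a <= x <= b ->
    Rabs (h 0%nat x - taylor_poly h a k x) <= B * ((x - a) ^ k / INR (fact k)).
Proof.
induction k as [|k IH]; intros h a b B Hc Hd HB x Hx.
- simpl; replace (h 0%nat x - 0) with (h 0%nat x) by ring.
  specialize (HB x Hx); lra.
- assert (H1 : forall y, a <= y <= b ->
    Rabs (h 1%nat y - taylor_poly (fun i => h (S i)) a k y)
      <= B * ((y - a) ^ k / INR (fact k))).
  { intros y Hy; apply (IH (fun i => h (S i)) a b B).
    - intros j z Hj; apply Hc; lia.
    - intros j z Hj; apply Hd; lia.
    - exact HB.
    - exact Hy. }
  (* Both signs of the error at once. *)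
  assert (Hs : forall s, s = 1 \/ s = -1 ->
    s * (h 0%nat x - taylor_poly h a (S k) x)
      <= B * ((x - a) ^ S k / INR (fact (S k)))).
  { intros s Hs.
    assert (Hle := le_of_nonneg_derive
      (fun y => B * ((y - a) ^ S k / INR (fact (S k)))
                - s * (h 0%nat y - taylor_poly h a (S k) y))
      (fun y => B * ((y - a) ^ k / INR (fact k))
                - s * (h 1%nat y - taylor_poly (fun i => h (S i)) a k y)) a x).
    cbv beta in Hle.
    rewrite taylor_poly_center in Hle.
    rewrite (Rminus_diag a), (Rminus_diag (h 0%nat a)) in Hle.
    rewrite pow_ne_zero in Hle by lia.
    assert (Hpoly : forall y, is_derive
      (fun y => B * ((y - a) ^ S k / INR (fact (S k)))) y
      (B * ((y - a) ^ k / INR (fact k)))).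
    { intros y; apply (is_derive_scal (fun t => (t - a) ^ S k / INR (fact (S k)))).
      apply is_derive_pow_fact. }
    enough (B * (0 / INR (fact (S k))) - s * 0
      <= B * ((x - a) ^ S k / INR (fact (S k)))
         - s * (h 0%nat x - taylor_poly h a (S k) x)) by (unfold Rdiv in *; lra).
    apply Hle.
    - lra.
    - intros y Hy.
      apply (continuous_minus (fun y => B * ((y - a) ^ S k / INR (fact (S k))))).
      + apply (ex_derive_continuous (V := R_NormedModule)).
        eexists; apply Hpoly.
      + apply (continuous_scal_r s (fun y => h 0%nat y - taylor_poly h a (S k) y)).
        apply (continuous_minus (h 0%nat)); [apply Hc; [lia|lra]|].
        apply (ex_derive_continuous (V := R_NormedModule)).
        eexists; apply is_derive_taylor_poly.
    - intros y Hy.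
      apply (is_derive_minus (fun y => B * ((y - a) ^ S k / INR (fact (S k)))));
        [apply Hpoly|].
      apply (is_derive_scal (fun y => h 0%nat y - taylor_poly h a (S k) y)).
      apply (is_derive_minus (h 0%nat)); [apply Hd; [lia|lra]|].
      apply is_derive_taylor_poly.
    - intros y Hy.
      assert (Hy1 := H1 y ltac:(lra)); apply Rabs_le_between in Hy1.
      destruct Hs as [-> | ->]; lra. }
  apply Rabs_le_between; split.
  + specialize (Hs (-1) ltac:(now right)); lra.
  + specialize (Hs 1 ltac:(now left)); lra.
Qed.

(** One step of the Euler-Maclaurin formula for [g = h 1], with primitive [h 0].
    Expanding [h 0], [g], [g'] and [g'''] at [a] up to the seventh derivative of
    [h 0], all lower-order terms of the left-hand side cancel because 1/2, 1/12
    and 1/720 come from the Bernoulli numbers; the four remainders add up to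
    at most [B]. *)
Lemma euler_maclaurin_step (h : nat -> R -> R) (a B : R) :
  (forall j x, (j < 7)%nat -> a <= x <= a + 1 -> continuous (h j) x) ->
  (forall j x, (j < 7)%nat -> a < x < a + 1 -> is_derive (h j) x (h (S j) x)) ->
  (forall x, a <= x <= a + 1 -> Rabs (h 7%nat x) <= B) ->
  let T x := h 0%nat x - h 1%nat x / 2 + h 2%nat x / 12 - h 4%nat x / 720 in
  Rabs (T (a + 1) - T a - h 1%nat a) <= B.
Proof.
intros Hc Hd HB T.
assert (Htaylor : forall i, (i <= 7)%nat ->
  Rabs (h i (a + 1) - taylor_poly (fun j => h (i + j)%nat) a (7 - i) (a + 1))
    <= B * ((a + 1 - a) ^ (7 - i) / INR (fact (7 - i)))).
{ intros i Hi.
  assert (H := taylor_remainder (7 - i) (fun j => h (i + j)%nat) a (a + 1) B).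
  cbv beta in H; rewrite Nat.add_0_r in H; apply H.
  - intros j x Hj; apply Hc; lia.
  - intros j x Hj; rewrite Nat.add_succ_r; apply Hd; lia.
  - replace (i + (7 - i))%nat with 7%nat by lia; exact HB.
  - lra. }
assert (H0 := Htaylor 0%nat ltac:(lia)).
assert (H1 := Htaylor 1%nat ltac:(lia)).
assert (H2 := Htaylor 2%nat ltac:(lia)).
assert (H4 := Htaylor 4%nat ltac:(lia)).
clear Htaylor.
replace (a + 1 - a) with 1 in * by ring.
assert (HB0 : 0 <= B).
{ specialize (HB a ltac:(lra)); assert (H := Rabs_pos (h 7%nat a)); lra. }
cbn [taylor_poly Nat.sub Nat.add] in *.
replace (a + 1 - a) with 1 in * by ring.
rewrite !pow1 in *.
rewrite !fact_simpl in *; cbn [fact] in *; rewrite !mult_INR in *.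
rewrite !INR_IZR_INZ in *; simpl IZR in *.
apply Rabs_le_between in H0, H1, H2, H4.
apply Rabs_le_between; unfold T.
lra.
Qed.

(** * The summand and its derivatives *)

(** The derivatives of [f] made total: each is continuous on the whole line
    (through the constant extension to the left of 0), while differentiability
    holds on the open half-line only. The exponent 5 is what the sixth derivative
    of the summand needs: its worst term loses three powers, and two must be left
    for a summable bound. *)
Definition decaying_chain (D : nat -> R -> R) (K : R) : Prop :=
  (forall j x, (j <= 6)%nat -> continuous (D j) x) /\
  (forall j x, (j < 6)%nat -> 0 < x -> is_derive (D j) x (D (S j) x)) /\
  (forall j x, (j <= 6)%nat -> 0 <= x -> (1 + x) ^ 5 * Rabs (D j x) <= K).

Definition node (mu x : R) : R := mu * (x * (x + 1)).

(** With [u = 2x + 1] one has [d/dx node mu x = mu u], so these terms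
    [u^m f^(j)(mu x (x+1))] span a space stable under differentiation; it contains
    the summand [u f(mu x (x+1))]. *)
Definition monomial (D : nat -> R -> R) (mu : R) (m j : nat) (x : R) : R :=
  (2 * x + 1) ^ m * D j (node mu x).

(** Index 1 is the summand [g x = (2x+1) f(mu x (x+1))]; index 0 is its
    primitive, and index [k] is the derivative of [g] of order [k - 1]. *)
Definition summand_chain (D : nat -> R -> R) (mu : R) (k : nat) (x : R) : R :=
  match k with
  | 0%nat => RInt (D 0%nat) 0 (node mu x) / mu
  | 1%nat => monomial D mu 1 0 x
  | 2%nat => 2 * monomial D mu 0 0 x + mu * monomial D mu 2 1 x
  | 3%nat => 6 * mu * monomial D mu 1 1 x + mu ^ 2 * monomial D mu 3 2 x
  | 4%nat => 12 * mu * monomial D mu 0 1 x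
             + (12 * mu ^ 2 * monomial D mu 2 2 x + mu ^ 3 * monomial D mu 4 3 x)
  | 5%nat => 60 * mu ^ 2 * monomial D mu 1 2 x
             + (20 * mu ^ 3 * monomial D mu 3 3 x + mu ^ 4 * monomial D mu 5 4 x)
  | 6%nat => 120 * mu ^ 2 * monomial D mu 0 2 x
             + (180 * mu ^ 3 * monomial D mu 2 3 x
                + (30 * mu ^ 4 * monomial D mu 4 4 x + mu ^ 5 * monomial D mu 6 5 x))
  | _ => 840 * mu ^ 3 * monomial D mu 1 3 x
         + (420 * mu ^ 4 * monomial D mu 3 4 x
            + (42 * mu ^ 5 * monomial D mu 5 5 x + mu ^ 6 * monomial D mu 7 6 x))
  end.

Lemma decay_constant_ge0 D K : decaying_chain D K -> 0 <= K.
Proof.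
intros (_ & _ & HK); specialize (HK 0%nat 0 ltac:(lia) ltac:(lra)).
assert (H := Rabs_pos (D 0%nat 0)); simpl in HK; lra.
Qed.

Lemma decay_square D K t :
  decaying_chain D K -> 0 <= t -> Rabs (D 0%nat t) <= K / (1 + t) ^ 2.
Proof.
intros (_ & _ & HK) Ht; specialize (HK 0%nat t ltac:(lia) Ht).
apply Rle_div_r; [apply Rlt_gt, pow_lt; lra|].
apply Rle_trans with (2 := HK); rewrite Rmult_comm.
apply Rmult_le_compat_r; [apply Rabs_pos|].
apply Rle_pow; [lra|lia].
Qed.

Lemma node_ge0 (mu x : R) : 0 < mu -> 0 <= x -> 0 <= node mu x.
Proof. intros; unfold node; apply Rmult_le_pos; nra. Qed.

Lemma is_derive_node (mu x : R) :
  is_derive (node mu) x (mu * (2 * x + 1)).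
Proof. unfold node; auto_derive; [easy|ring]. Qed.

Lemma continuous_monomial D K mu m j x :
  decaying_chain D K -> (j <= 6)%nat -> continuous (monomial D mu m j) x.
Proof.
intros [Hc _] Hj.
apply (continuous_mult (fun x => (2 * x + 1) ^ m) (fun x => D j (node mu x))).
- apply (ex_derive_continuous (V := R_NormedModule)); auto_derive; easy.
- apply (continuous_comp (node mu) (D j)); [|now apply Hc].
  apply (ex_derive_continuous (V := R_NormedModule)).
  eexists; apply is_derive_node.
Qed.

Lemma is_derive_monomial D K mu m j x :
  decaying_chain D K -> 0 < mu -> 0 < x -> (j < 6)%nat ->
  is_derive (monomial D mu m j) x
    (2 * INR m * monomial D mu (pred m) j x + mu * monomial D mu (S m) (S j) x).
Proof.
intros (_ & Hd & _) Hmu Hx Hj; unfold monomial.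
assert (HX : 0 < node mu x) by (unfold node; apply Rmult_lt_0_compat; nra).
assert (H1 : is_derive (fun x => D j (node mu x)) x
               (scal (mu * (2 * x + 1)) (D (S j) (node mu x)))).
{ apply (is_derive_comp (D j) (node mu)); [now apply Hd|apply is_derive_node]. }
assert (H2 : is_derive (fun x => (2 * x + 1) ^ m) x
               (2 * INR m * (2 * x + 1) ^ pred m)) by (auto_derive; [easy|ring]).
assert (H := is_derive_mult _ _ x _ _ H2 H1 Rmult_comm).
eapply eq_ind; [exact H|].
unfold plus, mult, scal; simpl; unfold mult; simpl; ring.
Qed.

Lemma is_derive_antiderivative D K y :
  decaying_chain D K -> is_derive (RInt (D 0%nat) 0) y (D 0%nat y).
Proof.
intros [Hc _].
apply (is_derive_RInt (D 0%nat) (RInt (D 0%nat) 0) 0); [|apply Hc; lia].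
apply filter_forall; intros b.
apply (RInt_correct (V := R_CompleteNormedModule)).
apply (ex_RInt_continuous (V := R_CompleteNormedModule)).
intros z _; apply Hc; lia.
Qed.

Lemma is_derive_summand_chain D K mu k x :
  decaying_chain D K -> 0 < mu -> 0 < x -> (k < 7)%nat ->
  is_derive (summand_chain D mu k) x (summand_chain D mu (S k) x).
Proof.
intros HD Hmu Hx Hk.
assert (Hs : forall c m j, (j < 6)%nat ->
  is_derive (fun x => c * monomial D mu m j x) x
    (c * (2 * INR m * monomial D mu (pred m) j x
          + mu * monomial D mu (S m) (S j) x))).
{ intros c m j Hj; apply (is_derive_scal (monomial D mu m j)).
  now apply is_derive_monomial with K. }
assert (Hp : forall (p q : R -> R) dp dq dr,
  is_derive p x dp -> is_derive q x dq -> dr = dp + dq ->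
  is_derive (fun x => p x + q x) x dr).
{ intros p q dp dq dr Hp Hq ->; now apply (is_derive_plus p q). }
assert (He : forall (p : R -> R) d d', is_derive p x d -> d = d' -> is_derive p x d')
  by (intros p d d' H <-; exact H).
destruct k as [|[|[|[|[|[|[|k]]]]]]]; [..|lia]; unfold summand_chain.
- assert (H := is_derive_comp _ _ x _ _
                 (is_derive_antiderivative D K (node mu x) HD) (is_derive_node mu x)).
  apply (is_derive_scal _ x (/ mu)) in H.
  eapply (is_derive_ext _ _ x) in H; [eapply He; [exact H|]|].
  + unfold monomial, scal; simpl; unfold mult; simpl; field; lra.
  + intros t; simpl; field; lra.
- eapply He; [apply is_derive_monomial with K; trivial; lia|]; simpl; ring.
- eapply Hp; [apply Hs; lia|apply Hs; lia|simpl; ring].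
- eapply Hp; [apply Hs; lia|apply Hs; lia|simpl; ring].
- eapply Hp; [apply Hs; lia|eapply Hp; [apply Hs; lia|apply Hs; lia|reflexivity]|].
  simpl; ring.
- eapply Hp; [apply Hs; lia|eapply Hp; [apply Hs; lia|apply Hs; lia|reflexivity]|].
  simpl; ring.
- eapply Hp; [apply Hs; lia|eapply Hp; [apply Hs; lia|
    eapply Hp; [apply Hs; lia|apply Hs; lia|reflexivity]|reflexivity]|].
  simpl; ring.
Qed.

Lemma continuous_summand_chain D K mu k x :
  decaying_chain D K -> 0 < mu -> (k < 7)%nat ->
  continuous (summand_chain D mu k) x.
Proof.
intros HD Hmu Hk.
assert (Hs : forall c m j, (j <= 6)%nat ->
  continuous (fun x => c * monomial D mu m j x) x).
{ intros c m j Hj; apply (continuous_scal_r c (monomial D mu m j)).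
  now apply continuous_monomial with K. }
assert (Hp : forall p q : R -> R,
  continuous p x -> continuous q x -> continuous (fun x => p x + q x) x).
{ intros p q Hp Hq; now apply (continuous_plus p q). }
destruct k as [|[|[|[|[|[|[|k]]]]]]]; [..|lia]; unfold summand_chain.
{ apply (ex_derive_continuous (V := R_NormedModule)).
  exists (/ mu * scal (mu * (2 * x + 1)) (D 0%nat (node mu x))).
  apply is_derive_ext with (fun x => / mu * RInt (D 0%nat) 0 (node mu x)).
  - intros t; simpl; field; lra.
  - apply (is_derive_scal (fun x => RInt (D 0%nat) 0 (node mu x))).
    apply (is_derive_comp (RInt (D 0%nat) 0) (node mu));
      [now apply is_derive_antiderivative with K|apply is_derive_node]. }
{ apply continuous_monomial with K; [exact HD|lia]. }
all: repeat apply Hp; apply Hs; lia.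
Qed.

(** * Estimates uniform in [mu] *)

(** The inverse of the natural scale [1 + mu x (x+1)]. Since
    [mu (2x+1)^2 <= 4 (1 + mu x (x+1))] when [mu <= 1], every estimate below is
    expressed with powers of this quantity. *)
Definition weight (mu x : R) : R := / (1 + node mu x).

Lemma weight_bounds mu x : 0 < mu -> 0 <= x -> 0 < weight mu x <= 1.
Proof.
intros Hmu Hx; assert (H := node_ge0 mu x Hmu Hx); unfold weight; split.
- apply Rinv_0_lt_compat; lra.
- rewrite <- Rinv_1; apply Rinv_le_contravar; lra.
Qed.

(** Each factor [mu u^2] is at most [4 / w] with [w = weight mu x], and
    [f^(j)] is at most [K w^5]; three such factors still leave [w^2].
    The constant is [64 = 4^3]. *)
Lemma monomial_bound D K mu i j x :
  decaying_chain D K -> 0 < mu <= 1 -> 0 <= x -> (i <= 3)%nat -> (j <= 6)%nat ->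
  Rabs (mu ^ i * monomial D mu (2 * i) j x) <= 64 * K * weight mu x ^ 2.
Proof.
intros (_ & _ & HK) [Hmu Hmu1] Hx Hi Hj.
assert (Hn := node_ge0 mu x Hmu Hx).
assert (Hw := weight_bounds mu x Hmu Hx).
specialize (HK j (node mu x) Hj Hn).
unfold monomial.
replace (mu ^ i * ((2 * x + 1) ^ (2 * i) * D j (node mu x)))
  with ((mu * (2 * x + 1) ^ 2) ^ i * D j (node mu x))
  by (rewrite Rpow_mult_distr, <- pow_mult; ring).
assert (Hv : 0 <= mu * (2 * x + 1) ^ 2 <= 4 * / weight mu x).
{ unfold weight; rewrite Rinv_inv; unfold node in *; split; nra. }
assert (HwE : 1 + node mu x = / weight mu x) by (unfold weight; now rewrite Rinv_inv).
rewrite HwE in HK.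
set (v := mu * (2 * x + 1) ^ 2) in *; set (w := weight mu x) in *.
rewrite Rabs_mult, <- RPow_abs, (Rabs_right v) by lra.
assert (Hd : Rabs (D j (node mu x)) <= K * w ^ 5).
{ apply Rmult_le_reg_l with ((/ w) ^ 5).
  - apply pow_lt, Rinv_0_lt_compat; lra.
  - replace ((/ w) ^ 5 * (K * w ^ 5)) with K; [exact HK|field; lra]. }
assert (HK0 : 0 <= K).
{ apply Rle_trans with (2 := HK); apply Rmult_le_pos; [|apply Rabs_pos].
  apply pow_le, Rlt_le, Rinv_0_lt_compat; lra. }
apply Rle_trans with ((4 * / w) ^ i * (K * w ^ 5)).
{ apply Rmult_le_compat; [apply pow_le; lra|apply Rabs_pos| |exact Hd].
  apply pow_incr; lra. }
assert (Hw2 : 0 <= K * w ^ 2) by (apply Rmult_le_pos; [lra|apply pow_le; lra]).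
assert (Hb : 4 ^ i * w ^ (3 - i) <= 64).
{ do 4 (destruct i as [|i]; [simpl; nra|]); lia. }
replace ((4 * / w) ^ i * (K * w ^ 5)) with ((4 ^ i * w ^ (3 - i)) * (K * w ^ 2)).
{ replace (64 * K * w ^ 2) with (64 * (K * w ^ 2)) by ring.
  apply Rmult_le_compat_r; lra. }
rewrite Rpow_mult_distr, pow_inv.
replace (w ^ 5) with (w ^ i * w ^ (3 - i) * w ^ 2)
  by (rewrite <- !pow_add; f_equal; lia).
field; apply pow_nonzero; lra.
Qed.

(** The difference is of the size of [mu u w^2]: this is what makes the error
    bounds telescope. *)
Lemma weight_diff mu x : 0 < mu -> 0 <= x ->
  weight mu x - weight mu (x + 1)
    = mu * (2 * x + 2) * (weight mu x * weight mu (x + 1)).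
Proof.
intros Hmu Hx.
assert (H := node_ge0 mu x Hmu Hx).
assert (H1 := node_ge0 mu (x + 1) Hmu ltac:(lra)).
unfold weight; unfold node in *; field; split; lra.
Qed.

Lemma weight_antitone mu x y : 0 < mu -> 0 <= x <= y -> weight mu y <= weight mu x.
Proof.
intros Hmu Hxy; unfold weight; apply Rinv_le_contravar.
- assert (H := node_ge0 mu x Hmu (proj1 Hxy)); lra.
- unfold node; apply Rplus_le_compat_l, Rmult_le_compat_l; nra.
Qed.

(** Consecutive weights are comparable uniformly in [mu <= 1]: up to a positive
    factor the difference of the two sides is [2 + 2 mu (x^2 - 1)]. *)
Lemma weight_le_succ mu x : 0 < mu <= 1 -> 0 <= x ->
  weight mu x <= 3 * weight mu (x + 1).
Proof.
intros [Hmu Hmu1] Hx.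
assert (H := node_ge0 mu x Hmu Hx).
assert (H1 := node_ge0 mu (x + 1) Hmu ltac:(lra)).
assert (Hsq : 0 <= 2 + 2 * mu * (x ^ 2 - 1)) by (assert (Hm := pow2_ge_0 x); nra).
unfold weight.
apply Rmult_le_reg_l with (1 + node mu x); [lra|].
apply Rmult_le_reg_l with (1 + node mu (x + 1)); [lra|].
replace ((1 + node mu (x + 1)) * ((1 + node mu x) * / (1 + node mu x)))
  with (1 + node mu (x + 1)) by (field; lra).
replace ((1 + node mu (x + 1))
   * ((1 + node mu x) * (3 * / (1 + node mu (x + 1)))))
  with (3 * (1 + node mu x)) by (field; lra).
unfold node in *; nra.
Qed.

(** Factoring [mu^3 u] out of [g^(6)] leaves terms [(mu u^2)^i f^(j)] with
    [i <= 3], whence [|g^(6)| <= C mu^3 u w^2]. One factor [mu u w^2] is absorbed in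
    a telescoping difference of weights, and [mu^2] remains. *)
Lemma summand_chain_top_bound D K mu n x :
  decaying_chain D K -> 0 < mu <= 1 -> INR n <= x <= INR n + 1 ->
  Rabs (summand_chain D mu 7 x)
    <= 375264 * K * mu ^ 2 * (weight mu (INR n) - weight mu (INR n + 1)).
Proof.
intros HD Hmu Hx.
assert (Hn := pos_INR n).
assert (Hx0 : 0 <= x) by lra.
assert (H3 := monomial_bound D K mu 0 3 x HD Hmu Hx0 ltac:(lia) ltac:(lia)).
assert (H4 := monomial_bound D K mu 1 4 x HD Hmu Hx0 ltac:(lia) ltac:(lia)).
assert (H5 := monomial_bound D K mu 2 5 x HD Hmu Hx0 ltac:(lia) ltac:(lia)).
assert (H6 := monomial_bound D K mu 3 6 x HD Hmu Hx0 ltac:(lia) ltac:(lia)).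
simpl Nat.mul in *.
set (w := weight mu x) in *.
assert (Hfac : summand_chain D mu 7 x = mu ^ 3 * (2 * x + 1) *
  (840 * (mu ^ 0 * monomial D mu 0 3 x) + 420 * (mu ^ 1 * monomial D mu 2 4 x)
   + 42 * (mu ^ 2 * monomial D mu 4 5 x) + mu ^ 3 * monomial D mu 6 6 x)).
{ unfold summand_chain, monomial; ring. }
assert (HKw : 0 <= 64 * K * w ^ 2) by (apply Rle_trans with (2 := H3); apply Rabs_pos).
assert (Hc : 0 < mu ^ 3) by (apply pow_lt; lra).
assert (HK := decay_constant_ge0 D K HD).
assert (Hw := weight_bounds mu x (proj1 Hmu) Hx0); fold w in Hw.
assert (Hwn := weight_antitone mu (INR n) x (proj1 Hmu) ltac:(lra)); fold w in Hwn.
assert (Hwn1 := weight_le_succ mu (INR n) Hmu Hn).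
rewrite weight_diff by lra.
rewrite Hfac, Rabs_mult, (Rabs_right (mu ^ 3 * (2 * x + 1))) by nra.
apply Rle_trans with (mu ^ 3 * (2 * INR n + 3) * (1303 * (64 * K * weight mu (INR n) ^ 2))).
- apply Rmult_le_compat; [nra|apply Rabs_pos|apply Rmult_le_compat_l; lra|].
  apply Rle_trans with (1303 * (64 * K * w ^ 2)).
  + apply Rabs_le_between in H3, H4, H5, H6; apply Rabs_le_between; lra.
  + apply Rmult_le_compat_l; [lra|]; apply Rmult_le_compat_l; [lra|].
    apply pow_incr; lra.
- replace (375264 * K * mu ^ 2 * (mu * (2 * INR n + 2)
             * (weight mu (INR n) * weight mu (INR n + 1))))
    with (mu ^ 3 * (83392 * K) * ((3 / 2 * (2 * INR n + 2))
             * (weight mu (INR n) * (3 * weight mu (INR n + 1))))) by field.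
  (* 375264 = 64 * 1303 * 3/2 * 3, where 1303 = 840 + 420 + 42 + 1; the factor
     3/2 comes from [2n+3 <= 3/2 (2n+2)] and 3 from consecutive weights. *)
  replace (mu ^ 3 * (2 * INR n + 3) * (1303 * (64 * K * weight mu (INR n) ^ 2)))
    with (mu ^ 3 * (83392 * K) * ((2 * INR n + 3)
             * (weight mu (INR n) * weight mu (INR n)))) by ring.
  apply Rmult_le_compat_l; [apply Rmult_le_pos; lra|].
  apply Rmult_le_compat; [lra|nra|lra|].
  apply Rmult_le_compat_l; lra.
Qed.

(** * Summation of the steps *)

(** The combination whose increment over [n, n+1] reproduces [g n] up to an
    error controlled by [g^(6)]. *)
Definition corrected_primitive (D : nat -> R -> R) (mu x : R) : R :=
  summand_chain D mu 0 x - summand_chain D mu 1 x / 2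
  + summand_chain D mu 2 x / 12 - summand_chain D mu 4 x / 720.

Lemma corrected_primitive_step D K mu n :
  decaying_chain D K -> 0 < mu <= 1 ->
  Rabs (corrected_primitive D mu (INR (S n)) - corrected_primitive D mu (INR n)
        - summand_chain D mu 1 (INR n))
    <= 375264 * K * mu ^ 2 * (weight mu (INR n) - weight mu (INR (S n))).
Proof.
intros HD Hmu; rewrite S_INR.
assert (Hn := pos_INR n).
apply (euler_maclaurin_step (summand_chain D mu)).
- intros j x Hj _; apply continuous_summand_chain with K; trivial; lra.
- intros j x Hj Hx; apply is_derive_summand_chain with K; trivial; lra.
- intros x Hx; now apply summand_chain_top_bound.
Qed.

(** Telescoping of the unit steps. The sum of the theorem starts at 1 whereas the
    telescoping starts at 0, so the term [g 0 = f 0] is moved out by hand. *)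
Lemma partial_sum_bound D K mu n :
  decaying_chain D K -> 0 < mu <= 1 ->
  Rabs (corrected_primitive D mu (INR (S (S n))) - corrected_primitive D mu 0
        - D 0%nat 0 - sum_n (fun k => summand_chain D mu 1 (INR (S k))) n)
    <= 375264 * K * mu ^ 2 * (1 - weight mu (INR (S (S n)))).
Proof.
intros HD Hmu.
assert (Hstep := fun n => corrected_primitive_step D K mu n HD Hmu).
induction n as [|n IH].
- rewrite sum_O.
  assert (H0 := Hstep 0%nat); assert (H1 := Hstep 1%nat).
  change (INR 0) with 0 in H0.
  replace (weight mu 0) with 1 in H0
    by (unfold weight, node; rewrite !Rmult_0_l, Rmult_0_r, Rplus_0_r; now rewrite Rinv_1).
  replace (summand_chain D mu 1 0) with (D 0%nat 0) in H0.
  2: { unfold summand_chain, monomial, node; rewrite !Rmult_0_l, !Rmult_0_r; ring. }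
  apply Rabs_le_between in H0, H1; apply Rabs_le_between; lra.
- rewrite sum_Sn.
  change (plus ?a ?b) with (a + b).
  assert (H1 := Hstep (S (S n))).
  apply Rabs_le_between in IH, H1; apply Rabs_le_between; lra.
Qed.

(** * Limits at infinity *)

(** Compare with [K / (1 + t)], a primitive of minus the bound of [|f|]. *)
Lemma antiderivative_variation D K x y :
  decaying_chain D K -> 0 <= x <= y ->
  Rabs (RInt (D 0%nat) 0 y - RInt (D 0%nat) 0 x) <= K / (1 + x).
Proof.
intros HD Hxy.
assert (HK0 : 0 <= K / (1 + y))
  by (apply Rdiv_le_0_compat; [now apply decay_constant_ge0 with D|lra]).
assert (Hs : forall s, s = 1 \/ s = -1 ->
  s * (RInt (D 0%nat) 0 y - RInt (D 0%nat) 0 x) <= K / (1 + x)).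
{ intros s Hs.
  assert (Hd : forall t, 0 <= t ->
    is_derive (fun t => - (K / (1 + t)) - s * RInt (D 0%nat) 0 t) t
              (K / (1 + t) ^ 2 - s * D 0%nat t)).
  { intros t Ht.
    apply (is_derive_minus (fun t => - (K / (1 + t))) (fun t => s * RInt (D 0%nat) 0 t)).
    - auto_derive; [lra|field; lra].
    - apply (is_derive_scal (RInt (D 0%nat) 0)).
      now apply is_derive_antiderivative with K. }
  assert (H := le_of_nonneg_derive
    (fun t => - (K / (1 + t)) - s * RInt (D 0%nat) 0 t)
    (fun t => K / (1 + t) ^ 2 - s * D 0%nat t) x y (proj2 Hxy)).
  cbv beta in H.
  enough (- (K / (1 + x)) - s * RInt (D 0%nat) 0 x
          <= - (K / (1 + y)) - s * RInt (D 0%nat) 0 y) by lra.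
  apply H.
  { intros t Ht; apply (ex_derive_continuous (V := R_NormedModule)).
    eexists; apply Hd; lra. }
  { intros t Ht; apply Hd; lra. }
  intros t Ht; assert (HK := decay_square D K t HD ltac:(lra)); apply Rabs_le_between in HK.
  destruct Hs as [-> | ->]; lra. }
apply Rabs_le_between; split.
- specialize (Hs (-1) ltac:(now right)); lra.
- specialize (Hs 1 ltac:(now left)); lra.
Qed.

Lemma antiderivative_cv D K :
  decaying_chain D K ->
  exists l : R, filterlim (RInt (D 0%nat) 0) (Rbar_locally p_infty) (locally l).
Proof.
intros HD.
apply (filterlim_locally_cauchy (U := R_CompleteSpace)); intros eps.
assert (Heps := cond_pos eps).
assert (HK := decay_constant_ge0 D K HD).
assert (HKe : 0 <= K / eps) by (apply Rdiv_le_0_compat; lra).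
assert (Hlt : forall x y, K / eps < x <= y ->
  Rabs (RInt (D 0%nat) 0 y - RInt (D 0%nat) 0 x) < eps).
{ intros x y Hxy.
  apply Rle_lt_trans with (K / (1 + x));
    [apply antiderivative_variation; [exact HD|lra]|].
  apply Rlt_div_l; [lra|].
  destruct Hxy as [Hxy _]; apply Rlt_div_l in Hxy; [|lra].
  rewrite Rmult_comm in Hxy; lra. }
exists (fun x => K / eps < x); split; [now exists (K / eps)|].
intros u v Hu Hv; change (Rabs (RInt (D 0%nat) 0 v - RInt (D 0%nat) 0 u) < eps).
destruct (Rle_or_lt u v).
- apply Hlt; lra.
- rewrite Rabs_minus_sym; apply Hlt; lra.
Qed.

Lemma node_INR_cv mu : 0 < mu -> is_lim_seq (fun n => node mu (INR n)) p_infty.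
Proof.
intros Hmu.
apply is_lim_seq_le_p_loc with (fun n => mu * INR n).
- exists 0%nat; intros n _; unfold node; assert (H := pos_INR n).
  apply Rmult_le_compat_l; nra.
- replace p_infty with (Rbar_mult mu p_infty).
  + apply is_lim_seq_scal_l, is_lim_seq_INR.
  + apply is_Rbar_mult_unique, is_Rbar_mult_sym, is_Rbar_mult_p_infty_pos; exact Hmu.
Qed.

(** The terms [g], [g'], [g'''] vanish at infinity: they are at most
    [C u w^2], and [mu u^2 w <= 4] turns [u w^2] into [1 / (mu u)]. *)
Lemma corrected_primitive_error D K mu x :
  decaying_chain D K -> 0 < mu <= 1 -> 0 <= x ->
  Rabs (corrected_primitive D mu x - summand_chain D mu 0 x)
    <= 256 * K / mu * / (2 * x + 1).
Proof.
intros HD Hmu Hx.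
assert (H00 := monomial_bound D K mu 0 0 x HD Hmu Hx ltac:(lia) ltac:(lia)).
assert (H21 := monomial_bound D K mu 1 1 x HD Hmu Hx ltac:(lia) ltac:(lia)).
assert (H01 := monomial_bound D K mu 0 1 x HD Hmu Hx ltac:(lia) ltac:(lia)).
assert (H22 := monomial_bound D K mu 1 2 x HD Hmu Hx ltac:(lia) ltac:(lia)).
assert (H43 := monomial_bound D K mu 2 3 x HD Hmu Hx ltac:(lia) ltac:(lia)).
simpl Nat.mul in *.
assert (Hw := weight_bounds mu x (proj1 Hmu) Hx).
set (B := 64 * K * weight mu x ^ 2) in *.
assert (HB : 0 <= B) by (apply Rle_trans with (2 := H00); apply Rabs_pos).
assert (HBu : (2 * x + 1) * B <= 256 * K / mu * / (2 * x + 1)).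
{ assert (HK := decay_constant_ge0 D K HD).
  assert (Hu : mu * (2 * x + 1) ^ 2 * weight mu x <= 4).
  { assert (Hn := node_ge0 mu x (proj1 Hmu) Hx).
    unfold weight; apply Rle_div_l; [lra|]; unfold node in *; nra. }
  assert (Hu2 : mu * (2 * x + 1) ^ 2 * weight mu x ^ 2 <= 4).
  { assert (0 <= mu * (2 * x + 1) ^ 2 * weight mu x).
    { apply Rmult_le_pos; [apply Rmult_le_pos; [lra|apply pow2_ge_0]|lra]. }
    simpl; rewrite Rmult_1_r, <- Rmult_assoc; simpl in *; nra. }
  replace (256 * K / mu * / (2 * x + 1)) with (4 * (64 * K / (mu * (2 * x + 1))))
    by (field; lra).
  replace ((2 * x + 1) * B) with
    (mu * (2 * x + 1) ^ 2 * weight mu x ^ 2 * (64 * K / (mu * (2 * x + 1))))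
    by (unfold B; field; lra).
  apply Rmult_le_compat_r; [|exact Hu2].
  apply Rdiv_le_0_compat; [lra|apply Rmult_lt_0_compat; lra]. }
apply Rle_trans with (2 := HBu).
assert (H10 : Rabs (monomial D mu 1 0 x) <= (2 * x + 1) * B).
{ replace (monomial D mu 1 0 x) with ((2 * x + 1) * (mu ^ 0 * monomial D mu 0 0 x))
    by (unfold monomial; ring).
  rewrite Rabs_mult, Rabs_right by lra; apply Rmult_le_compat_l; lra. }
assert (H4 : Rabs (summand_chain D mu 4 x) <= 25 * B).
{ replace (summand_chain D mu 4 x) with (mu * (12 * (mu ^ 0 * monomial D mu 0 1 x)
    + 12 * (mu ^ 1 * monomial D mu 2 2 x) + mu ^ 2 * monomial D mu 4 3 x))
    by (unfold summand_chain; ring).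
  rewrite Rabs_mult, Rabs_right by lra.
  assert (H : Rabs (12 * (mu ^ 0 * monomial D mu 0 1 x)
    + 12 * (mu ^ 1 * monomial D mu 2 2 x) + mu ^ 2 * monomial D mu 4 3 x) <= 25 * B).
  { apply Rabs_le_between in H01, H22, H43; apply Rabs_le_between; lra. }
  rewrite <- (Rmult_1_l (25 * B)).
  apply Rmult_le_compat; [lra|apply Rabs_pos|lra|exact H]. }
assert (HuB : B <= (2 * x + 1) * B) by nra.
unfold corrected_primitive.
change (summand_chain D mu 1 x) with (monomial D mu 1 0 x).
change (summand_chain D mu 2 x)
  with (2 * monomial D mu 0 0 x + mu * monomial D mu 2 1 x).
rewrite pow_O, Rmult_1_l in H00; rewrite pow_1 in H21.
apply Rabs_le_between in H00, H21, H10, H4; apply Rabs_le_between; lra.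
Qed.

Lemma corrected_primitive_cv D K mu l :
  decaying_chain D K -> 0 < mu <= 1 ->
  filterlim (RInt (D 0%nat) 0) (Rbar_locally p_infty) (locally l) ->
  is_lim_seq (fun n => corrected_primitive D mu (INR n)) (l / mu).
Proof.
intros HD Hmu Hl.
assert (H0 : is_lim_seq (fun n => summand_chain D mu 0 (INR n)) (l / mu)).
{ apply (is_lim_seq_scal_r (fun n => RInt (D 0%nat) 0 (node mu (INR n))) (/ mu) l).
  apply (filterlim_comp _ _ _ (fun n => node mu (INR n)) (RInt (D 0%nat) 0) _
           (Rbar_locally p_infty)); [now apply node_INR_cv|exact Hl]. }
assert (H1 : is_lim_seq (fun n => corrected_primitive D mu (INR n)
                                  - summand_chain D mu 0 (INR n)) 0).
{ apply is_lim_seq_abs_0.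
  apply is_lim_seq_le_le with (fun _ => 0) (fun n => 256 * K / mu * / (2 * INR n + 1)).
  - intros n; split; [apply Rabs_pos|].
    apply corrected_primitive_error; [exact HD|exact Hmu|apply pos_INR].
  - apply is_lim_seq_const.
  - replace (Finite 0) with (Rbar_mult (256 * K / mu) 0) by (simpl; f_equal; ring).
    apply is_lim_seq_scal_l.
    replace (Finite 0) with (Rbar_inv p_infty) by reflexivity.
    apply is_lim_seq_inv; [|discriminate].
    apply is_lim_seq_le_p_loc with INR; [|apply is_lim_seq_INR].
    exists 0%nat; intros n _; assert (H := pos_INR n); lra. }
assert (H := is_lim_seq_plus' _ _ _ _ H0 H1).
rewrite Rplus_0_r in H.
apply is_lim_seq_ext with (2 := H); intros n; ring.
Qed.

Lemma ex_series_telescope_le (a b : nat -> R) (c : R) :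
  (forall n, Rabs (a n) <= c * (b n - b (S n))) -> is_lim_seq b 0 -> ex_series a.
Proof.
intros Hab Hb.
apply (ex_series_le (V := R_CompleteNormedModule) a (fun n => c * (b n - b (S n))));
  [exact Hab|].
exists (c * (b 0%nat - 0)).
apply (is_series_scal_l (V := R_NormedModule) c (fun n => b n - b (S n)) (b 0%nat - 0)).
assert (Hsum : forall n, sum_n (fun n => b n - b (S n)) n = b 0%nat - b (S n)).
{ induction n as [|n IH]; [now rewrite sum_O|].
  rewrite sum_Sn, IH; unfold plus; simpl; ring. }
apply (is_lim_seq_ext (fun n => b 0%nat - b (S n)) _ (b 0%nat - 0));
  [intros n; now rewrite Hsum|].
apply is_lim_seq_minus'; [apply is_lim_seq_const|].
now apply is_lim_seq_incr_1 in Hb.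
Qed.

(** Valid for every [mu > 0], unlike the uniform estimates above: the term of
    index [n] is compared with the difference of the weights at [n - 1] and [n]. *)
Lemma ex_series_summand D K mu :
  decaying_chain D K -> 0 < mu ->
  ex_series (fun k => summand_chain D mu 1 (INR (S k))).
Proof.
intros HD Hmu.
apply (ex_series_telescope_le _ (fun k => weight mu (INR k)) (3 / 2 * K / mu)).
- intros k; rewrite S_INR; assert (Hk := pos_INR k).
  rewrite weight_diff by lra.
  assert (Hn := node_ge0 mu (INR k + 1) Hmu ltac:(lra)).
  assert (Hw := weight_bounds mu (INR k + 1) Hmu ltac:(lra)).
  assert (Hwk := weight_antitone mu (INR k) (INR k + 1) Hmu ltac:(lra)).
  assert (HK0 := decay_constant_ge0 D K HD).
  assert (Hdec := decay_square D K _ HD Hn).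
  unfold Rdiv in Hdec; rewrite <- pow_inv in Hdec.
  fold (weight mu (INR k + 1)) in Hdec.
  unfold summand_chain, monomial; rewrite pow_1, Rabs_mult, Rabs_right by lra.
  replace (3 / 2 * K / mu
           * (mu * (2 * INR k + 2) * (weight mu (INR k) * weight mu (INR k + 1))))
    with ((3 / 2 * (2 * INR k + 2)) * (K * (weight mu (INR k) * weight mu (INR k + 1))))
    by (field; lra).
  apply Rmult_le_compat; [lra|apply Rabs_pos|lra|].
  apply Rle_trans with (1 := Hdec), Rmult_le_compat_l; [lra|].
  simpl; rewrite Rmult_1_r; apply Rmult_le_compat_r; lra.
- replace (Finite 0) with (Rbar_inv p_infty) by reflexivity.
  apply is_lim_seq_inv; [|discriminate].
  apply is_lim_seq_le_p_loc with (fun n => node mu (INR n)); [|now apply node_INR_cv].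
  exists 0%nat; intros n _; lra.
Qed.

(** The boundary terms at 0, source of the coefficients of the expansion:
    [-1/2 + 2/12 = -1/3] for [f 0] and [1/12 - 12/720 = 1/15] for [mu f' 0]. *)
Lemma corrected_primitive_0 D mu :
  corrected_primitive D mu 0
    = - (1 / 3) * D 0%nat 0 + 1 / 15 * mu * D 1%nat 0
      - mu ^ 2 * (12 * D 2%nat 0 + mu * D 3%nat 0) / 720.
Proof.
unfold corrected_primitive, summand_chain, monomial.
replace (node mu 0) with 0 by (unfold node; ring).
rewrite RInt_point; unfold zero; simpl.
replace (0 / mu) with 0 by (unfold Rdiv; ring).
field.
Qed.

(** Passing to the limit in the partial sums gives [mu^-1 l - T 0 - f 0] up to
    [O(mu^2)], where [T] is the corrected primitive; the [f''] and [f'''] terms of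
    [T 0] carry a factor [mu^2]. *)
Lemma series_asymptotics D K mu l :
  decaying_chain D K -> 0 < mu <= 1 ->
  filterlim (RInt (D 0%nat) 0) (Rbar_locally p_infty) (locally l) ->
  Rabs (Series (fun k => summand_chain D mu 1 (INR (S k)))
        - (1 / mu * l - 2 / 3 * D 0%nat 0 - 1 / 15 * mu * D 1%nat 0))
    <= (375264 * K + (12 * Rabs (D 2%nat 0) + Rabs (D 3%nat 0)) / 720) * mu ^ 2.
Proof.
intros HD Hmu Hl.
assert (HK := decay_constant_ge0 D K HD).
set (S := Series (fun k => summand_chain D mu 1 (INR (Datatypes.S k)))).
assert (HS : is_lim_seq (sum_n (fun k => summand_chain D mu 1 (INR (Datatypes.S k)))) S).
{ apply (Series_correct (fun k => summand_chain D mu 1 (INR (Datatypes.S k)))).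
  apply ex_series_summand with K; [exact HD|lra]. }
assert (HT := corrected_primitive_cv D K mu l HD Hmu Hl).
apply is_lim_seq_incr_1, is_lim_seq_incr_1 in HT.
assert (Hmain : Rabs (l / mu - corrected_primitive D mu 0 - D 0%nat 0 - S)
                <= 375264 * K * mu ^ 2).
{ apply (is_lim_seq_le
    (fun n => Rabs (corrected_primitive D mu (INR (Datatypes.S (Datatypes.S n)))
       - corrected_primitive D mu 0 - D 0%nat 0
       - sum_n (fun k => summand_chain D mu 1 (INR (Datatypes.S k))) n))
    (fun _ => 375264 * K * mu ^ 2)
    (Rabs (l / mu - corrected_primitive D mu 0 - D 0%nat 0 - S))
    (375264 * K * mu ^ 2)).
  - intros n; apply Rle_trans with (1 := partial_sum_bound D K mu n HD Hmu).
    assert (Hw := weight_bounds mu (INR (Datatypes.S (Datatypes.S n)))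
                    (proj1 Hmu) (pos_INR _)).
    assert (H2 := pow2_ge_0 mu).
    rewrite <- (Rmult_1_r (375264 * K * mu ^ 2)) at 2.
    apply Rmult_le_compat_l; [apply Rmult_le_pos; lra|lra].
  - apply (is_lim_seq_abs _ (l / mu - corrected_primitive D mu 0 - D 0%nat 0 - S)).
    apply is_lim_seq_minus'; [|exact HS].
    apply is_lim_seq_minus'; [|apply is_lim_seq_const].
    apply is_lim_seq_minus'; [exact HT|apply is_lim_seq_const].
  - apply is_lim_seq_const. }
rewrite corrected_primitive_0 in Hmain.
assert (Htail : Rabs (mu ^ 2 * (12 * D 2%nat 0 + mu * D 3%nat 0) / 720)
   <= (12 * Rabs (D 2%nat 0) + Rabs (D 3%nat 0)) / 720 * mu ^ 2).
{ replace (mu ^ 2 * (12 * D 2%nat 0 + mu * D 3%nat 0) / 720)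
    with (mu ^ 2 * ((12 * D 2%nat 0 + mu * D 3%nat 0) / 720)) by field.
  rewrite Rabs_mult, (Rabs_right (mu ^ 2)) by (apply Rle_ge, pow2_ge_0).
  rewrite Rmult_comm; apply Rmult_le_compat_r; [apply pow2_ge_0|].
  assert (Hm : Rabs (mu * D 3%nat 0) <= Rabs (D 3%nat 0)).
  { rewrite Rabs_mult, (Rabs_right mu) by lra.
    assert (H := Rabs_pos (D 3%nat 0)); nra. }
  assert (H2 := Rle_abs (D 2%nat 0)); assert (H2' := Rabs_maj2 (D 2%nat 0)).
  apply Rabs_le_between in Hm; apply Rabs_le_between; lra. }
replace (l / mu) with (1 / mu * l) in Hmain by (field; lra).
apply Rabs_le_between in Hmain, Htail; apply Rabs_le_between; lra.
Qed.

(** * From the half-line to the whole line *)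

Lemma continuous_within_extension (g : R -> R) (x : R) :
  filterlim g (within half_line (locally (Rmax 0 x))) (locally (g (Rmax 0 x))) ->
  continuous (fun y => g (Rmax 0 y)) x.
Proof.
intros Hg.
apply (filterlim_comp _ _ _ (Rmax 0) g _ (within half_line (locally (Rmax 0 x))));
  [|exact Hg].
intros P [eps HP]; exists eps; intros y Hy; apply HP; [|apply Rmax_l].
change (Rabs (Rmax 0 y - Rmax 0 x) < eps); change (Rabs (y - x) < eps) in Hy.
apply Rle_lt_trans with (2 := Hy).
unfold Rmax; destruct (Rle_dec 0 y), (Rle_dec 0 x); unfold Rabs;
  repeat destruct Rcase_abs; lra.
Qed.

Lemma is_derive_extension (g : R -> R) (x l : R) :
  0 < x -> is_derive_half g x l -> is_derive (fun y => g (Rmax 0 y)) x l.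
Proof.
intros Hx Hg.
apply is_derive_ext_loc with g.
- exists (mkposreal x Hx); intros y Hy; change (Rabs (y - x) < x) in Hy.
  rewrite Rmax_right; [reflexivity|].
  apply Rabs_def2 in Hy; lra.
- destruct Hg as [Hlin Hg]; split; [apply is_linear_scal_l|].
  intros z Hz eps.
  assert (Hw : is_filter_lim (within half_line (locally x)) z)
    by (intros P HP; apply filter_le_within, Hz, HP).
  destruct (Hg z Hw eps) as [d Hd].
  exists (mkposreal (Rmin d x) (Rmin_stable_in_posreal d (mkposreal x Hx))).
  intros y Hy; change (Rabs (y - x) < Rmin d x) in Hy.
  apply Hd.
  + apply Rlt_le_trans with (1 := Hy), Rmin_l.
  + apply Rlt_le_trans with (r3 := x) in Hy; [|apply Rmin_r].
    apply Rabs_def2 in Hy; unfold half_line; lra.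
Qed.

(** Precomposing with [Rmax 0] turns continuity relative to the half-line into
    two-sided continuity, while on [x > 0] the half-line derivative is an
    ordinary one. *)
Lemma decaying_chain_extension (f : R -> R) (df : nat -> R -> R) :
  Cn_half 6 f df ->
  (forall j : nat, (j <= 6)%nat ->
     exists K : R, forall x : R, 0 <= x -> Rpower (1 + x) 5 * Rabs (df j x) <= K) ->
  exists K, decaying_chain (fun j x => df j (Rmax 0 x)) K.
Proof.
intros (_ & Hd & Hc) HK.
assert (Hbound : exists K, forall j x, (j <= 6)%nat -> 0 <= x ->
  (1 + x) ^ 5 * Rabs (df j x) <= K).
{ assert (H : forall n, (n <= 6)%nat -> exists K, forall j x, (j <= n)%nat -> 0 <= x ->
    (1 + x) ^ 5 * Rabs (df j x) <= K).
  { assert (Hp : forall x, 0 <= x -> Rpower (1 + x) 5 = (1 + x) ^ 5).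
    { intros x Hx; rewrite <- (Rpower_pow 5) by lra.
      now rewrite INR_IZR_INZ. }
    induction n as [|n IH]; intros Hn.
    - destruct (HK 0%nat Hn) as [K H]; exists K; intros j x Hj Hx.
      replace j with 0%nat by lia; rewrite <- Hp by exact Hx; now apply H.
    - destruct (HK (S n) Hn) as [K H]; destruct (IH ltac:(lia)) as [K' H'].
      exists (Rmax K K'); intros j x Hj Hx.
      destruct (Nat.eq_dec j (S n)) as [-> | Hne].
      + rewrite <- Hp by exact Hx.
        apply Rle_trans with (2 := Rmax_l _ _); now apply H.
      + apply Rle_trans with (2 := Rmax_r _ _); apply H'; [lia|exact Hx]. }
  now apply H. }
destruct Hbound as [K HK']; exists K; split; [|split].
- intros j x Hj; apply continuous_within_extension.
  assert (Hx : half_line (Rmax 0 x)) by apply Rmax_l.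
  destruct (Nat.eq_dec j 6) as [-> | Hne]; [now apply Hc|].
  assert (Hj6 : (j < 6)%nat) by lia.
  apply (filterdiff_continuous_aux (U := R_NormedModule) (V := R_NormedModule) (df j));
    [eexists; exact (Hd j _ Hj6 Hx)|].
  intros P HP; apply filter_le_within, HP.
- intros j x Hj Hx.
  rewrite (Rmax_right 0 x) by lra.
  apply is_derive_extension; [exact Hx|]; apply Hd; [exact Hj|apply Rlt_le, Hx].
- intros j x Hj Hx; rewrite Rmax_right by exact Hx; now apply HK'.
Qed.

Theorem lemma3p14 :
  exists (N : nat) (M : R), (1 <= N)%nat /\ 0 < M /\
    forall (f : R -> R) (df : nat -> R -> R),
      Cn_half N f df ->
      (forall j : nat, (j <= N)%nat ->
         exists K : R, forall x : R, 0 <= x ->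
           Rpower (1 + x) M * Rabs (df j x) <= K) ->
      (forall mu : R, 0 < mu -> ex_series (fun k : nat => F_term f mu (S k))) /\
      ex_RInt_gen f (at_point 0) (Rbar_locally p_infty) /\
      exists C : R,
        at_right 0 (fun mu : R =>
          Rabs (F f mu
                - (1 / mu * RInt_gen f (at_point 0) (Rbar_locally p_infty)
                   - 2 / 3 * f 0
                   - 1 / 15 * mu * df 1%nat 0))
          <= C * mu ^ 2).
Proof.
(* Six derivatives make the summed errors of order [mu^2], since a step uses
   [g^(6)], which involves [f^(6)]; for 5 see [decaying_chain]. *)
exists 6%nat, 5; split; [lia|split; [lra|]].
intros f df Hf HK.
destruct (decaying_chain_extension f df Hf HK) as [K HD].
destruct Hf as [Hf0 _].
set (D := fun j x => df j (Rmax 0 x)) in HD.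
assert (HDf : forall x, 0 <= x -> D 0%nat x = f x).
{ intros x Hx; unfold D; rewrite Rmax_right by exact Hx; now apply Hf0. }
assert (Hterm : forall mu n, 0 < mu -> summand_chain D mu 1 (INR n) = F_term f mu n).
{ intros mu n Hmu; unfold F_term; rewrite <- HDf.
  - unfold summand_chain, monomial, node; now rewrite pow_1.
  - apply node_ge0; [exact Hmu|apply pos_INR]. }
destruct (antiderivative_cv D K HD) as [l Hl].
assert (HI : is_RInt_gen f (at_point 0) (Rbar_locally p_infty) l).
{ intros P HP; destruct (Hl P HP) as [A HA].
  apply (Filter_prod _ _ _ (fun x => x = 0) (fun y => Rmax 0 A < y)).
  - reflexivity.
  - now exists (Rmax 0 A).
  - intros x y -> Hy; simpl.
    assert (H0 := Rmax_l 0 A); assert (H1 := Rmax_r 0 A).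
    exists (RInt (D 0%nat) 0 y); split; [|apply HA; lra].
    apply (is_RInt_ext (D 0%nat)).
    + intros t Ht; rewrite Rmin_left in Ht by lra; apply HDf; lra.
    + apply (RInt_correct (V := R_CompleteNormedModule)).
      apply (ex_RInt_continuous (V := R_CompleteNormedModule)).
      intros z _; apply (proj1 HD); lia. }
split; [|split].
- intros mu Hmu.
  apply ex_series_ext with (2 := ex_series_summand D K mu HD Hmu).
  intros k; now apply Hterm.
- now exists l.
- rewrite (is_RInt_gen_unique (V := R_CompleteNormedModule) f l HI).
  exists (375264 * K + (12 * Rabs (D 2%nat 0) + Rabs (D 3%nat 0)) / 720).
  exists (mkposreal 1 Rlt_0_1); intros mu Hmu Hmu0.
  change (Rabs (mu - 0) < 1) in Hmu; apply Rabs_def2 in Hmu.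
  assert (H := series_asymptotics D K mu l HD ltac:(lra) Hl).
  rewrite HDf in H by lra.
  replace (df 1%nat 0) with (D 1%nat 0) by (unfold D; now rewrite Rmax_left by lra).
  unfold F; rewrite <- (Series_ext _ _ (fun k => Hterm mu (S k) Hmu0)); exact H.
Qed.
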